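(* The proposed DPP ratio indexing algorithm for the multi-user file downloading problem (described in the context) achieves the constraint $$\limsup_{T\to\infty}\frac1T\sum_{t=0}^{T-1}\sum_{n=1}^Np_n(\alpha_n(t))\le\beta.$$
   Context: **Model.** Slotted time, $N$ users, $M<N$. User $n$ has file state $F_n(t)\in\{0,1\}$, action set $\mathcal A_n$ containing an idle action $0$, completion probability function $\phi_n:\mathcal A_n\to[0,1]$ with $\phi_n(0)=0$, power function $p_n:\mathcal A_n\to[0,\infty)$ with $p_n(0)=0$, idle parameter $\lambda_n>0$, mean file size $\overline B_n$ and weight $c_n>0$. If $F_n(t)=0$ then $\alpha_n(t)=0$. Transitions: $\Pr[F_n(t+1)=1|F_n(t)=0]=\lambda_n$, $\Pr[F_n(t+1)=0|F_n(t)=1]=\phi_n(\alpha_n(t))$, with randomness of different users mutually independent. At most $M$ users may have $\alpha_n(t)\ne0$ on each slot. $\beta>0$ is the power budget. **Assumption.** The following are finite and strictly positive: $p_n^{\min}=\min_{\alpha_n\in\mathcal A_n\setminus\{0\}}p_n(\alpha_n)$, $p^{\min}=\min_np_n^{\min}$, $p_n^{\max}=\max_{\alpha_n\in\mathcal A_n}p_n(\alpha_n)$, $c^{\max}=\max_nc_n$, $\overline B^{\max}=\max_n\overline B_n$. **DPP ratio indexing algorithm** (parameter $V\ge0$). Virtual queue $Q(0)=0$, $Q(t+1)=\max\{Q(t)+\sum_{n=1}^Np_n(\alpha_n(t))-\beta,0\}$. Let $\mathcal N(t)=\{n:F_n(t)=1\}$. On each slot $t$, for $n\in\mathcal N(t)$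 let $$g_n(\alpha_n)=\frac{Vc_n\overline B_n\phi_n(\alpha_n)-Q(t)p_n(\alpha_n)}{1+\phi_n(\alpha_n)/\lambda_n},\qquad\gamma_n(t)=\max_{\alpha_n\in\mathcal A_n}g_n(\alpha_n).$$ Activate the $\min[M,|\mathcal N(t)|]$ users of $\mathcal N(t)$ with greatest indices $\gamma_n(t)$, each using an action $\alpha_n(t)\in\mathcal A_n$ that maximizes $g_n$; all other users use $\alpha_n(t)=0$. Then update $Q$. *)

(* Defs.v *)
From HB Require Import structures.
From mathcomp Require Export all_boot all_order all_algebra.
From mathcomp Require Export all_classical all_reals all_analysis.
Export Order.TTheory GRing.Theory Num.Theory.
Export numFieldNormedType.Exports.

#[global] Set Implicit Arguments.
#[global] Unset Strict Implicit.
#[global] Unset Printing Implicit Defensive.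

#[global] Open Scope classical_set_scope.
#[global] Open Scope ring_scope.

(* Attained extrema: [is_max S m] fails when the supremum of S is not reached. *)
Definition is_max (R : realType) (S : set R) (m : R) : Prop :=
  S m /\ ubound S m.
Definition is_min (R : realType) (S : set R) (m : R) : Prop :=
  S m /\ lbound S m.

(* The action sets are abstract, possibly infinite, and differ between users.
   They carry sigma-algebras (a discrete one is allowed) only so that actions
   can be random and can appear in the history of the system. *)
Record download_system (R : realType) (N : nat) := DownloadSystem {
  act_disp : 'I_N -> measure_display;
  action : forall n : 'I_N, measurableType (act_disp n);
  idle : forall n : 'I_N, action n;
  phi : forall n : 'I_N, action n -> R;
  power : forall n : 'I_N, action n -> R;
  lambda : 'I_N -> R;
  mean_size : 'I_N -> R;
  weight : 'I_N -> R;
  phi_ge0_le1 : forall (n : 'I_N) (a : action n), 0 <= phi a <= 1;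
  phi_idle : forall n : 'I_N, phi (idle n) = 0;
  power_ge0 : forall (n : 'I_N) (a : action n), 0 <= power a;
  power_idle : forall n : 'I_N, power (idle n) = 0;
  lambda_gt0 : forall n : 'I_N, 0 < lambda n;
  weight_gt0 : forall n : 'I_N, 0 < weight n;
  measurable_phi : forall n : 'I_N, measurable_fun setT (@phi n);
  measurable_power : forall n : 'I_N, measurable_fun setT (@power n)
}.

Section System.
Variables (R : realType) (N : nat) (sys : download_system R N).

(* Joint action of all users on one slot. *)
Definition actions : Type := forall n : 'I_N, action sys n.

Definition power_assumption : Prop :=
  exists (pmin_ pmax_ : 'I_N -> R) (pmin cmax Bmax : R),
    (forall n : 'I_N,
       is_min [set r | exists2 a : action sys n, a <> idle sys n & r = power a]
              (pmin_ n) /\ 0 < pmin_ n) /\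
    (is_min (range pmin_) pmin /\ 0 < pmin) /\
    (forall n : 'I_N,
       is_max (range (@power R N sys n)) (pmax_ n) /\ 0 < pmax_ n) /\
    (is_max (range (weight sys)) cmax /\ 0 < cmax) /\
    (is_max (range (mean_size sys)) Bmax /\ 0 < Bmax).

Definition total_power (a : actions) : R := \sum_(n < N) power (a n).

(* Probability that the file state of user n moves from f to f' under a. *)
Definition transition (n : 'I_N) (f : bool) (a : action sys n) (f' : bool) : R :=
  match f, f' with
  | false, true => lambda sys n
  | false, false => 1 - lambda sys n
  | true, false => phi a
  | true, true => 1 - phi a
  end.

Section Process.
Variables (d : measure_display) (Omega : measurableType d).
Variables (P : probability Omega R).
(* F t w n = true means that user n has an active file on slot t. *)
Variables (F : nat -> Omega -> 'I_N -> bool) (alpha : nat -> Omega -> actions).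

(* Generators of the sigma-algebra of file states and actions up to slot t. *)
Definition history (t : nat) : set (set Omega) :=
  [set G | exists (s : nat) (n : 'I_N), (s <= t)%N /\
     (G = [set w | F s w n] \/
      exists2 B : set (action sys n),
        measurable B & G = [set w | B (alpha s w n)])].

(* [step_law] is the integrated form of: conditionally on the history up to
   slot t, the next states of the users are mutually independent, with user n
   following [transition]. *)
Record controlled_process (M : nat) : Prop := ControlledProcess {
  measurable_state : forall (t : nat) (n : 'I_N), measurable [set w | F t w n];
  measurable_action : forall (t : nat) (n : 'I_N),
    measurable_fun setT (fun w => alpha t w n);
  step_law : forall (t : nat) (G : set Omega) (b : 'I_N -> bool),
    <<s history t >> G ->
    P (G `&` [set w | forall n : 'I_N, F t.+1 w n = b n]) =
    (\int[P]_(w in G)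
       (\prod_(n < N) transition (F t w n) (alpha t w n) (b n))%:E)%E;
  idle_without_file : forall (t : nat) (w : Omega) (n : 'I_N),
    F t w n = false -> alpha t w n = idle sys n;
  at_most_M_active : forall (t : nat) (w : Omega),
    (#|[set n : 'I_N | `[< alpha t w n <> idle sys n >]]%SET| <= M)%N
}.

End Process.

Fixpoint virtual_queue (beta : R) (a : nat -> actions) (t : nat) : R :=
  if t is s.+1
  then Num.max (virtual_queue beta a s + total_power (a s) - beta) 0
  else 0.

Definition dpp_ratio (V q : R) (n : 'I_N) (a : action sys n) : R :=
  (V * weight sys n * mean_size sys n * phi a - q * power a) /
  (1 + phi a / lambda sys n).

(* Decisions allowed on a slot with queue value q and file states f.
   K is the set of activated users; ties between indices, and between
   maximizing actions, may be broken in any way. *)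
Definition dpp_decision (M : nat) (V q : R) (f : 'I_N -> bool) (a : actions)
    : Prop :=
  exists (gamma : 'I_N -> R) (K : {set 'I_N}),
    (forall n : 'I_N, f n -> is_max (range (@dpp_ratio V q n)) (gamma n)) /\
    K \subset [set n | f n]%SET /\
    #|K| = minn M #|[set n | f n]%SET| /\
    (forall n m : 'I_N, n \in K -> f m -> m \notin K -> gamma m <= gamma n) /\
    (forall n : 'I_N, n \in K ->
       forall x : action sys n, dpp_ratio V q x <= dpp_ratio V q (a n)) /\
    (forall n : 'I_N, n \notin K -> a n = idle sys n).

Definition dpp_algorithm (M : nat) (V beta : R)
    (f : nat -> 'I_N -> bool) (a : nat -> actions) : Prop :=
  forall t : nat, dpp_decision M V (virtual_queue beta a t) (f t) (a t).

Definition average_power (a : nat -> actions) (T : nat) : R :=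
  T%:R^-1 * \sum_(0 <= t < T) total_power (a t).

End System.

(* Main.v *)
Require Import Defs.
From mathcomp Require Import lra.

(* On every sample path the virtual queue is bounded: once it exceeds
   V c^max B^max / p^min, each non-idle action has a negative ratio while the
   idle one has ratio 0, so all users idle and the queue cannot grow.  Since the
   queue dominates (power spent so far) - beta T, the time average of the power
   exceeds beta by at most O(1/T). *)

Section QueueBound.
Variables (R : realType) (N : nat) (sys : download_system R N).
Implicit Types (n : 'I_N) (a : actions sys).

Lemma dpp_ratio_idle (V q : R) n : dpp_ratio V q (idle sys n) = 0.
Proof. by rewrite /dpp_ratio phi_idle power_idle !mulr0 subr0 mul0r. Qed.

(** The denominator is positive, so only the numerator matters: its gain is at most
    [V * cmax * Bmax] because [phi x <= 1], while its cost is at least [q * pmin], which is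
    larger. *)
Lemma dpp_ratio_lt0 (V q pmin cmax Bmax : R) n (x : action sys n) :
  0 <= V -> 0 < pmin -> 0 <= Bmax ->
  weight sys n <= cmax -> mean_size sys n <= Bmax -> pmin <= power x ->
  V * cmax * Bmax / pmin < q -> dpp_ratio V q x < 0.
Proof.
move=> V0 p0 B0 cn Bn px qgt.
have /andP[ph0 ph1] := phi_ge0_le1 x.
have wn := ltW (weight_gt0 sys n).
have cmax0 : 0 <= cmax by exact: le_trans cn.
have C0 : 0 <= V * cmax * Bmax by rewrite !mulr_ge0.
have q0 : 0 <= q by apply: ltW; apply: le_lt_trans qgt; rewrite divr_ge0// ltW.
have qp : V * cmax * Bmax < q * power x.
  by move: qgt; rewrite ltr_pdivrMr// => /lt_le_trans; apply; rewrite ler_wpM2l.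
have gain : V * weight sys n * mean_size sys n * phi x <= V * cmax * Bmax.
  (* [mean_size] has no assumed sign, so it is replaced by [Bmax] before the weight is replaced by
     [cmax]: each factor kept fixed is then nonnegative. *)
  apply: (@le_trans _ _ (V * cmax * Bmax * phi x)); last exact: ler_piMr.
  apply: ler_wpM2r => //; apply: (@le_trans _ _ (V * weight sys n * Bmax)).
    by rewrite ler_wpM2l// mulr_ge0.
  by rewrite ler_wpM2r// ler_wpM2l.
rewrite /dpp_ratio pmulr_llt0 ?subr_lt0 ?(le_lt_trans gain)//.
by rewrite invr_gt0 ltr_pwDl// divr_ge0// ltW// lambda_gt0.
Qed.

(** An activated user maximizes the ratio, so its value is at least the idle value 0, which a
    non-idle action cannot reach above the threshold. *)
Lemma dpp_decision_idle (M : nat) (V q pmin cmax Bmax : R) f a :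
  0 <= V -> 0 < pmin -> 0 <= Bmax ->
  (forall n, weight sys n <= cmax) -> (forall n, mean_size sys n <= Bmax) ->
  (forall n (x : action sys n), x <> idle sys n -> pmin <= power x) ->
  V * cmax * Bmax / pmin < q -> dpp_decision M V q f a ->
  forall n, a n = idle sys n.
Proof.
move=> V0 p0 B0 cle Ble ple qgt [gam [K [_ [_ [_ [_ [Kmax Kidle]]]]]]] n.
have [nK|/Kidle//] := boolP (n \in K).
have [//|an] := pselect (a n = idle sys n).
have := Kmax n nK (idle sys n).
by rewrite dpp_ratio_idle leNgt (dpp_ratio_lt0 V0 p0 B0 (cle n) (Ble n) (ple _ _ an)).
Qed.

Lemma virtual_queue_ge0 (beta : R) (a : nat -> actions sys) t :
  0 <= virtual_queue beta a t.
Proof. by case: t => //= t; rewrite le_max lexx orbT. Qed.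

(** A slot that starts at or below [q0] adds at most [S]; one that starts above [q0] adds
    nothing. *)
Lemma virtual_queue_le (beta q0 S : R) (a : nat -> actions sys) :
  0 <= beta -> 0 <= q0 + S ->
  (forall t, total_power (a t) <= S) ->
  (forall t, q0 < virtual_queue beta a t -> total_power (a t) = 0) ->
  forall t, virtual_queue beta a t <= q0 + S.
Proof.
move=> b0 qS0 leS stop; elim=> [//|t IH] /=.
rewrite ge_max qS0 andbT.
have [Qle|/stop ->] := leP (virtual_queue beta a t) q0; last by lra.
by have := leS t; lra.
Qed.

(** Dropping the truncation at 0 gives a lower bound on each queue increment, and these bounds
    telescope from an empty queue. *)
Lemma sum_total_power_le (beta : R) (a : nat -> actions sys) T :
  \sum_(0 <= t < T) total_power (a t) <= virtual_queue beta a T + beta *+ T.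
Proof.
elim: T => [|T IH]; first by rewrite big_nil mulr0n addr0.
rewrite big_nat_recr//= mulrSr.
have : virtual_queue beta a T + total_power (a T) - beta <=
  Num.max (virtual_queue beta a T + total_power (a T) - beta) 0.
  by rewrite le_max lexx.
by lra.
Qed.

Lemma dpp_algorithm_queue_bounded (M : nat) (V beta : R)
    (f : nat -> 'I_N -> bool) (a : nat -> actions sys) :
  power_assumption sys -> 0 <= beta -> 0 <= V -> dpp_algorithm M V beta f a ->
  exists C : R, forall t, virtual_queue beta a t <= C.
Proof.
move=> [pmin_ [pmax_ [pmin [cmax [Bmax]]]]].
move=> [pminP [[[_ pmin_lb] pmin0] [pmaxP [[[_ cub] cmax0] [[_ Bub] B0]]]]].
move=> b0 V0 alg.
have cle n : weight sys n <= cmax by apply: cub; exists n.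
have Ble n : mean_size sys n <= Bmax by apply: Bub; exists n.
have ple n (x : action sys n) : x <> idle sys n -> pmin <= power x.
  move=> xi; apply: (@le_trans _ _ (pmin_ n)); first by apply: pmin_lb; exists n.
  by have [[_ lb] _] := pminP n; apply: lb; exists x.
have pub n (x : action sys n) : power x <= pmax_ n.
  by have [[_ ub] _] := pmaxP n; apply: ub; exists x.
(* The idling threshold plus the most power that one slot can use. *)
exists (V * cmax * Bmax / pmin + \sum_n pmax_ n).
apply: virtual_queue_le => // [|t|t qgt].
- apply: addr_ge0; first by rewrite divr_ge0 ?mulr_ge0// ltW.
  by apply: sumr_ge0 => n _; have [_ /ltW] := pmaxP n.
- by apply: ler_sum.
- apply: big1 => n _.
  by rewrite (dpp_decision_idle V0 pmin0 (ltW B0) cle Ble ple qgt (alg t)) power_idle.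
Qed.

End QueueBound.

(** The limit superior is an infimum of suprema over the sets of the filter, and the set where
    [u n <= x] is one of them. *)
Lemma limn_esup_le_near (R : realType) (u : nat -> \bar R) (x : \bar R) :
  (\forall n \near \oo, (u n <= x)%E) -> (limn_esup u <= x)%E.
Proof.
move=> ux; rewrite /limn_esup limf_esupE.
apply: (@le_trans _ _ (ereal_sup (u @` [set n | (u n <= x)%E]))).
  by apply: ereal_inf_lbound; exists [set n | (u n <= x)%E].
by apply: ge_ereal_sup => _ [n /= un <-].
Qed.

Theorem theorem4p3p1
  (R : realType) (N M : nat) (hMN : (M < N)%N)
  (sys : download_system R N) (hsys : power_assumption sys)
  (beta V : R) (hbeta : 0 < beta) (hV : 0 <= V)
  (d : measure_display) (Omega : measurableType d) (P : probability Omega R)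
  (F : nat -> Omega -> 'I_N -> bool) (alpha : nat -> Omega -> actions sys)
  (hproc : controlled_process P F alpha M)
  (halg : forall w : Omega,
     dpp_algorithm M V beta (fun t => F t w) (fun t => alpha t w)) :
  forall w : Omega,
    (limn_esup (fun T : nat => (average_power (fun t => alpha t w) T)%:E)
       <= beta%:E)%E.
Proof.
move=> w.
have [C QC] := dpp_algorithm_queue_bounded hsys (ltW hbeta) hV (halg w).
have C0 : 0 <= C by exact: le_trans (virtual_queue_ge0 _ _ 0) (QC 0).
apply/lee_addgt0Pr => e e0; apply: limn_esup_le_near.
(* The average exceeds [beta] by at most [C / T], which is below [e] once [T > C / e]. *)
have := nbhs_infty_gtr (C / e); apply: filterS => T Tgt.
have T0 : 0 < T%:R :> R by apply: le_lt_trans Tgt; rewrite divr_ge0// ltW.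
rewrite -EFinD lee_fin /average_power mulrC ler_pdivrMr//.
apply: le_trans (sum_total_power_le beta _ T) _.
have := QC T; move: Tgt; rewrite ltr_pdivrMr// -mulr_natr; lra.
Qed.
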